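(* Let $H$ be a bipartite graph with $h$ vertices and $\ell$ edges which is Erdős–Simonovits good. Let $\alpha$ and $A$ be positive reals such that $A\geq 16$, $\alpha>2-\frac{1}{m_2(H)}$, and $\mathrm{ex}(n,H)\leq An^\alpha$ for all $n$. Then there exist constants $\delta_H,k_0,C>0$ such that the following holds. Let $G$ be an $n$-vertex graph with $kn^\alpha$ edges, where $k\geq k_0$. Then $G$ contains a family $\mathcal{H}$ of copies of $H$ satisfying (1) $|\mathcal{H}|\geq \delta_H\,[e(G)]^{\ell}/n^{2\ell-h}$, and (2) for all $S\subseteq E(G)$ with $1\leq |S|\leq \ell$, $d_{\mathcal{H}}(S)\leq C\beta^{|S|-1}\frac{|\mathcal{H}|}{e(G)}$, where $\beta=\max\{(1/k)\,n^{-\phi(\alpha,H)},\ k^{-\lambda^*(\alpha,H)}\}$, $\phi(\alpha,H)=\frac{\alpha\ell-\alpha+h-2\ell}{\ell-1}$, and $\lambda^*(\alpha,H)=\frac{1}{m_2^*(H)(2-\alpha)}$.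
   Context: $\mathrm{ex}(n,H)$ is the maximum number of edges in an $n$-vertex $H$-free graph. For a family $\mathcal{H}$ of copies of $H$ in $G$ (each viewed as a set of edges) and $S\subseteq E(G)$, $d_{\mathcal{H}}(S)=|\{A\in\mathcal{H}:S\subseteq A\}|$. For a graph $H$ with at least $3$ vertices, $m_2(H)=\max\{\frac{e(F)-1}{v(F)-2}: F\subseteq H, v(F)>2\}$ and the proper $2$-density is $m_2^*(H)=\max\{\frac{e(F)-1}{v(F)-2}: F\subsetneq H, v(F)>2\}$. A bipartite graph $H$ with $h$ vertices and $\ell$ edges is Erdős–Simonovits good (with respect to $\alpha$, where $\mathrm{ex}(n,H)\le An^\alpha$ for all $n$) if there exist constants $C',c>0$ depending on $H$ such that for all sufficiently large $n$, every $n$-vertex graph $G$ with $e(G)>C'n^\alpha$ contains at least $c\,[e(G)]^{\ell}/n^{2\ell-h}$ copies of $H$. $H$ is assumed to have at least two edges. *)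

(* Defs.v *)
From HB Require Import structures.
From mathcomp Require Import all_boot all_order all_algebra.
From mathcomp Require Import reals exp.
Set Implicit Arguments.
Unset Strict Implicit.
Unset Printing Implicit Defensive.
Import Order.TTheory GRing.Theory Num.Theory.
Local Open Scope ring_scope.

Record sgraph (V : finType) := SGraph {
  edges : {set {set V}};
  edges_card2 : [forall e in edges, #|e| == 2%N]
}.

HB.instance Definition _ (V : finType) := [isSub for @edges V].
HB.instance Definition _ (V : finType) := [Finite of sgraph V by <:].

(* A pair of a vertex set and an edge set. Keeping the vertex set makes
   isolated vertices count, both in v(F) and in the number of copies. *)
Definition subgraph (V : finType) : finType := ({set V} * {set {set V}})%type.
Definition sub_verts (V : finType) (F : subgraph V) : {set V} := F.1.
Definition sub_edges (V : finType) (F : subgraph V) : {set {set V}} := F.2.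

Definition subgraphs (V : finType) (G : sgraph V) : {set subgraph V} :=
  [set F : subgraph V | (sub_edges F \subset edges G) &&
                        (sub_edges F \subset powerset (sub_verts F))].

Definition whole (V : finType) (G : sgraph V) : subgraph V :=
  ([set: V], edges G).

Definition copies (U V : finType) (H : sgraph U) (G : sgraph V) :
    {set subgraph V} :=
  [set F in subgraphs G |
    [exists f : {ffun U -> V},
      [&& injectiveb f,
          sub_verts F == [set f x | x : U] &
          sub_edges F == [set [set f x | x in (e : {set U})] | e in edges H]]]].

Definition H_free (U V : finType) (H : sgraph U) (G : sgraph V) : bool :=
  copies H G == set0.

Definition ex (U : finType) (n : nat) (H : sgraph U) : nat :=
  \max_(G : sgraph 'I_n | H_free H G) #|edges G|.

Definition bipartite (V : finType) (G : sgraph V) : Prop :=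
  exists X : {set V}, forall e, e \in edges G -> #|e :&: X| = 1%N.

Definition density (R : realType) (V : finType) (F : subgraph V) : R :=
  (#|sub_edges F|%:R - 1) / (#|sub_verts F|%:R - 2).

(* (e(F) - 1) / (v(F) - 2) >= -1 as soon as v(F) > 2, so the starting value -1
   leaves the two maxima below unchanged. *)
Definition m2 (R : realType) (V : finType) (H : sgraph V) : R :=
  \big[Num.max/-1]_(F in subgraphs H | (2 < #|sub_verts F|)%N) density R F.

Definition m2_star (R : realType) (V : finType) (H : sgraph V) : R :=
  \big[Num.max/-1]_(F in subgraphs H | (F != whole H) &&
                                       (2 < #|sub_verts F|)%N) density R F.

(* e ^ l / n ^ (2 l - h); the exponent 2 l - h is an integer, negative when H
   has enough isolated vertices. *)
Definition expected_copies (R : realType) (h l n e : nat) : R :=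
  e%:R ^+ l / n%:R ^ ((2 * l)%:Z - h%:Z).

Definition ES_good (R : realType) (h : nat) (H : sgraph 'I_h) (alpha : R) :
    Prop :=
  exists C' c : R, [/\ 0 < C', 0 < c &
    exists n0 : nat, forall (n : nat) (G : sgraph 'I_n), (n0 <= n)%N ->
      C' * n%:R `^ alpha < #|edges G|%:R ->
      c * expected_copies R h #|edges H| n #|edges G| <= #|copies H G|%:R].

Definition phi (R : realType) (h : nat) (H : sgraph 'I_h) (alpha : R) : R :=
  let l := #|edges H|%:R in
  (alpha * l - alpha + h%:R - 2 * l) / (l - 1).

Definition lambda_star (R : realType) (h : nat) (H : sgraph 'I_h) (alpha : R) :
    R :=
  1 / (m2_star R H * (2 - alpha)).

(* When H has two edges and no isolated vertex, m2_star H = 0. Then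
   lambda_star is +oo and k ^ (- lambda_star) is read as 0 (its limit for
   k > 1), instead of the value 1 that the convention 1 / 0 = 0 would give. *)
Definition beta (R : realType) (h : nat) (H : sgraph 'I_h) (alpha k : R)
    (n : nat) : R :=
  Num.max (1 / k * n%:R `^ (- phi H alpha))
          (if m2_star R H == 0 then 0 else k `^ (- lambda_star H alpha)).

Definition codegree (V : finType) (F : {set subgraph V}) (S : {set {set V}}) :
    nat :=
  #|[set A in F | S \subset sub_edges A]|.

(* Main.v *)
(* Let M = delta * expected_copies and D_j = C beta^(j-1) M / e(G), and take a
   maximal family F of copies in which every j-set of edges has codegree at
   most D_j.  If |F| < M, then every copy outside F contains a saturated edge
   set S, and double counting gives sum_S D_|S| <= 2^(l+1) M over these S.
   If H has no isolated vertex, the full edge set of a copy outside F has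
   codegree 0 in F, so it is not saturated; hence S comes from a proper
   subgraph of H, and (|S| - 1) / (v(S) - 2) <= m_2^*(H) as soon as |S| > 1.
   Now sample a vertex set W of size m ~ p n with p = K k^(-1/(2-alpha)), the
   density at which G[W] still has more than C' m^alpha edges.  The choice of
   beta makes p^(v(S)-2) <= const * beta^(|S|-1), so on average deleting one
   edge from each saturated S inside W destroys at most half of the edges of
   G[W].  The Erdos-Simonovits property in the pruned graph and averaging over
   W yield at least M copies of H in G containing no saturated set.  All these
   belong to F, a contradiction. *)

Require Import Defs.
From mathcomp Require Import all_boot all_order all_algebra.
From mathcomp Require Import reals exp.
From mathcomp Require Import zify ring lra.
Set Implicit Arguments.
Unset Strict Implicit.
Unset Printing Implicit Defensive.
Import Order.TTheory GRing.Theory Num.Theory.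
Local Open Scope ring_scope.

(** * Counting the m-subsets that contain a given set *)

(* The number of m-subsets of an n-set that contain a given v-set; without the
   test, truncated subtraction would give 1 for m < v. *)
Definition nsupersets (n m v : nat) : nat :=
  if (v <= m)%N then 'C(n - v, m - v) else 0%N.

Lemma card_supersets (V : finType) (T : {set V}) (m : nat) :
  #|[set W : {set V} | (T \subset W) && (#|W| == m)]| = nsupersets #|V| m #|T|.
Proof.
rewrite /nsupersets; case: leqP => [vm|mv]; last first.
  apply/eqP; rewrite cards_eq0; apply/eqP/setP => W; rewrite !inE.
  apply/negP => /andP[/subset_leq_card TW /eqP Wm].
  by move: mv; rewrite -Wm ltnNge TW.
have -> : (#|V| - #|T|)%N = #|~: T| by rewrite [#|~: T|]cardsCs setCK.
rewrite -cards_draws -[LHS](card_in_imset (f := fun W => W :\: T)); last first.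
  move=> W W'; rewrite !inE => /andP[TW _] /andP[TW' _] eqD.
  by rewrite -(setID W T) -(setID W' T) eqD (setIidPr TW) (setIidPr TW').
congr #|pred_of_set _|; apply/setP => X; rewrite !inE.
apply/imsetP/andP => [[W]|[XT /eqP Xm]].
  rewrite inE => /andP[TW /eqP Wm] ->; split.
    by apply/subsetP => x; rewrite !inE => /andP[].
  by rewrite cardsDS // Wm.
have dXT : [disjoint X & T] by rewrite disjoints_subset.
exists (X :|: T).
  rewrite inE subsetUr /= cardsU (disjoint_setI0 dXT) cards0 Xm subn0.
  by rewrite subnK.
by rewrite setDUl setDv setU0; apply/esym/setDidPl.
Qed.

(** By absorption of binomials the ratio of consecutive counts is (m - v) / (n - v), at most m / n
    because m <= n. *)
Lemma nsupersetsS (n m v : nat) : (m <= n)%N -> (v < n)%N ->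
  (n * nsupersets n m v.+1 <= m * nsupersets n m v)%N.
Proof.
rewrite /nsupersets => mn vn; case: (ltnP v m) => [vm|]; last by rewrite muln0.
rewrite (ltnW vm).
have e := mul_bin_diag (n - v) (m - v.+1).
rewrite -[(m - v.+1).+1]subSn // subSS -subnS in e.
have nv : (0 < n - v)%N by lia.
rewrite -(leq_pmul2l nv).
rewrite mulnCA e !mulnA leq_mul2r; apply/orP; right.
nia.
Qed.

Lemma nsupersets_geometric (R : realFieldType) (n m v w : nat) :
  (m <= n)%N -> (0 < n)%N -> (v + w <= n)%N ->
  (nsupersets n m (v + w))%:R <=
    (m%:R / n%:R : R) ^+ w * (nsupersets n m v)%:R.
Proof.
move=> mn n0; elim: w => [|w IH] vw; first by rewrite expr0 mul1r addn0.
have n0R : 0 < n%:R :> R by rewrite ltr0n.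
have q0 : 0 <= m%:R / n%:R :> R by rewrite divr_ge0 ?ler0n.
have vwn : (v + w < n)%N by rewrite -addnS.
have step := nsupersetsS mn vwn.
rewrite -(ler_nat R) !natrM in step.
have IH' := IH (ltnW vwn).
rewrite addnS exprS -mulrA.
apply: (le_trans _ (ler_wpM2l q0 IH')).
by rewrite mulrAC ler_pdivlMr // mulrC.
Qed.

(** A converse to the geometric bound, for pairs: the exact ratio is m (m - 1) / (n (n - 1)), and m
    <= 2 (m - 1) for m >= 2. *)
Lemma nsupersets2_ge (R : realFieldType) (n m : nat) :
  (2 <= m)%N -> (m <= n)%N ->
  (m%:R / n%:R : R) ^+ 2 * (nsupersets n m 0)%:R <=
    2 * (nsupersets n m 2)%:R.
Proof.
move=> m2 mn; rewrite /nsupersets m2 /= !subn0.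
have n2 : (2 <= n)%N := leq_trans m2 mn.
have e1 := mul_bin_diag n m.-1; have e2 := mul_bin_diag n.-1 m.-2.
have h1 : (m.-1).+1 = m by lia. have h2 : (m.-2).+1 = m.-1 by lia.
rewrite h1 in e1; rewrite h2 -!subn2 in e2.
have n0R : 0 < n%:R :> R by rewrite ltr0n; lia.
have -> : (m%:R / n%:R : R) ^+ 2 * ('C(n, m))%:R =
   (m * m * 'C(n, m))%N%:R / n%:R ^+ 2 by rewrite !natrM; field; exact: lt0r_neq0.
rewrite ler_pdivrMr ?exprn_gt0 // -natrX -!natrM ler_nat.
move: e1 e2; set x := 'C(n, m); set y := 'C(n.-1, m.-1).
set z := 'C(_, _) => e1 e2.
have e3 : (n * n.-1 * z = m * m.-1 * x)%N.
  by rewrite -mulnA e2 mulnCA e1 mulnCA mulnA.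
have : (m * m * x <= 2 * (m * m.-1 * x))%N.
  rewrite [X in (_ <= X)%N]mulnA leq_mul2r; apply/orP; right; nia.
rewrite -e3 => /leq_trans; apply.
have -> : (2 * z * n ^ 2 = 2 * (n * n * z))%N by rewrite -mulnn; ring.
by rewrite leq_mul2l leq_mul2r leq_mul2l leq_pred !orbT.
Qed.

(** * Copies of H and their restriction to a vertex set *)

Lemma copiesP (U V : finType) (H : sgraph U) (G : sgraph V) (A : subgraph V) :
  reflect (exists f : U -> V,
             [/\ injective f, A.1 = [set f x | x : U],
                 A.2 = [set f @: (e : {set U}) | e in edges H]
               & A.2 \subset edges G])
          (A \in copies H G).
Proof.
rewrite /copies /subgraphs /sub_edges /sub_verts !inE.
apply: (iffP andP) => [[/andP[AG _] /existsP[f]]|[f [finj A1 A2 AG]]].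
  case/and3P => /injectiveP finj /eqP A1 /eqP A2.
  by exists f.
rewrite AG /=; split.
  apply/subsetP => e; rewrite A2 => /imsetP[e' _ ->].
  by rewrite powersetE A1 imsetS ?subset_predT.
have fE : finfun f =1 f by move=> x; rewrite ffunE.
apply/existsP; exists (finfun f); apply/and3P; split.
- by apply/injectiveP => x y; rewrite !fE => /finj.
- by rewrite A1; apply/eqP/esym/eq_imset.
by rewrite A2; apply/eqP/eq_imset => e; apply: eq_imset.
Qed.

Lemma card_edge (V : finType) (G : sgraph V) (e : {set V}) :
  e \in edges G -> #|e| = 2%N.
Proof. by move: (edges_card2 G) => /forallP /(_ e) /implyP /[apply] /eqP. Qed.

Lemma card_copy_verts (U V : finType) (H : sgraph U) (G : sgraph V) A :
  A \in copies H G -> #|A.1| = #|U|.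
Proof. by case/copiesP => f [finj -> _ _]; rewrite card_imset. Qed.

Lemma card_copy_edges (U V : finType) (H : sgraph U) (G : sgraph V) A :
  A \in copies H G -> #|A.2| = #|edges H|.
Proof.
by case/copiesP => f [finj _ -> _]; rewrite card_imset //; apply: imset_inj.
Qed.

Lemma copy_edges_sub (U V : finType) (H : sgraph U) (G : sgraph V) A :
  A \in copies H G -> A.2 \subset edges G.
Proof. by case/copiesP => f []. Qed.

Lemma cover_copy_edges (U V : finType) (H : sgraph U) (G : sgraph V) A :
  A \in copies H G -> cover A.2 \subset A.1.
Proof.
case/copiesP => f [_ -> -> _]; apply/bigcupsP => _ /imsetP[e _ ->].
by rewrite imsetS ?subset_predT.
Qed.

(** Supersaturation speaks of graphs on ['I_m]; relabelling W by [enum_val] makes it applicable to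
    any edge set E inside W, and copies travel back injectively. *)
Lemma restricted_graph (U V : finType) (H : sgraph U) (G : sgraph V)
    (W : {set V}) (m : nat) (E : {set {set V}}) :
  #|W| = m -> E \subset edges G -> E \subset powerset W ->
  exists2 G' : sgraph 'I_m, #|edges G'| = #|E| &
    (#|copies H G'| <=
     #|[set A in copies H G | (A.1 \subset W) && (A.2 \subset E)]|)%N.
Proof.
move=> <- EG EW; pose f : 'I_#|W| -> V := enum_val.
have finj : injective f by apply: enum_val_inj.
have fW x : f x \in W by apply: enum_valP.
have Finj := imset_inj finj.
have E2 : [forall e in [set e : {set 'I_#|W|} | f @: e \in E], #|e| == 2%N].
  apply/forallP => e; apply/implyP; rewrite inE => eE.
  by rewrite -(card_imset _ finj) (card_edge (subsetP EG _ eE)).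
exists (SGraph E2) => /=.
  rewrite -(card_imset _ Finj); congr #|pred_of_set _|; apply/setP => e.
  apply/imsetP/idP => [[e' +  ->]|eE]; first by rewrite inE.
  have ee : e = f @: (f @^-1: e).
    apply/setP => x; apply/idP/imsetP => [xe|[y + ->]]; last by rewrite inE.
    have xW : x \in W.
      by move: (subsetP EW _ eE); rewrite powersetE => /subsetP; apply.
    exists (enum_rank_in xW x); rewrite ?inE /f enum_rankK_in //.
  by exists (f @^-1: e) => //; rewrite inE -ee.
pose F (A : subgraph 'I_#|W|) : subgraph V :=
  (f @: A.1, [set f @: (e : {set _}) | e in A.2]).
have FFinj : injective F.
  by move=> [A1 A2] [B1 B2] [] /Finj -> /(imset_inj Finj) ->.
rewrite -(card_imset _ FFinj); apply/subset_leq_card/subsetP => B.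
case/imsetP => A /copiesP[g [ginj A1 A2 AG]] ->.
have FAE : [set f @: (e : {set _}) | e in A.2] \subset E.
  apply/subsetP => _ /imsetP[e eA ->].
  by have := subsetP AG _ eA; rewrite inE.
rewrite inE /F /= FAE andbT; apply/andP; split.
  apply/copiesP; exists (f \o g); split => /=.
  - exact: inj_comp.
  - by rewrite A1 -imset_comp.
  - rewrite A2 -imset_comp; apply: eq_imset => e /=; exact/esym/imset_comp.
  - exact: subset_trans FAE EG.
by apply/subsetP => _ /imsetP[x _ ->].
Qed.

(** * Averaging over sampled vertex sets *)

Lemma sum_card_supersets (V I : finType) (X : {set I}) (t : I -> {set V})
    (m : nat) :
  (\sum_(W : {set V} | #|W| == m) #|[set x in X | t x \subset W]| =
   \sum_(x in X) nsupersets #|V| m #|t x|)%N.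
Proof.
have cE (W : {set V}) : #|[set x in X | t x \subset W]| =
    (\sum_(x in X) if t x \subset W then 1 else 0)%N.
  by rewrite -sum1_card -big_mkcondr; apply: eq_bigl => x; rewrite inE.
rewrite (eq_bigr _ (fun W _ => cE W)) exchange_big /=; apply: eq_bigr => x _.
rewrite -card_supersets -sum1_card -big_mkcondr /=.
by apply: eq_bigl => W; rewrite inE andbC.
Qed.

(* Replaces Jensen's inequality when averaging l-th powers over the sampled
   sets: the bound is linear in x, and trivial for x < a. *)
Lemma tangent_le (R : realFieldType) (a x : R) (l : nat) :
  0 <= a -> (0 < l)%N -> a <= x -> a ^+ l.-1 * (x - a) <= x ^+ l.
Proof.
case: l => // l a0 _ ax; rewrite exprSr /=.
have x0 := le_trans a0 ax.
apply: ler_pM; rewrite ?exprn_ge0 ?subr_ge0 ?lerXn2r ?nnegrE //.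
by rewrite lerBlDr lerDl.
Qed.

Lemma expected_copies_restrict (R : realType) (h l n m e : nat) :
  (0 < n)%N -> (0 < m)%N ->
  ((m%:R / n%:R : R) ^+ 2 * e%:R / 8) ^+ l / m%:R ^ ((2 * l)%:Z - h%:Z) =
  (m%:R / n%:R) ^+ h * (8 ^- l * expected_copies R h l n e).
Proof.
move=> n0 m0; rewrite /expected_copies.
have nN : n%:R != 0 :> R by rewrite pnatr_eq0 -lt0n.
have mN : m%:R != 0 :> R by rewrite pnatr_eq0 -lt0n.
rewrite !expfzDr // -!exprnN -!exprnP !exprM !exprMn !exprVn.
by field; rewrite !expf_eq0 (negPf nN) (negPf mN) pnatr_eq0 !andbF.
Qed.

Section Sampling.

Variables (R : realType) (h n m : nat) (H : sgraph 'I_h) (G : sgraph 'I_n).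
Variables (B : {set {set {set 'I_n}}}) (c a0 : R).
Let l := #|edges H|.
Let e : R := #|edges G|%:R.
Let q : R := m%:R / n%:R.
Let N v : R := (nsupersets n m v)%:R.
(** Half of the lower bound q^2 e / 4 on the average size of a pruned sample. *)
Let a : R := q ^+ 2 * e / 8.
Let good := [set A in copies H G | [forall S in B, ~~ (S \subset sub_edges A)]].
Let z : R := (m%:R ^ ((2 * l)%:Z - h%:Z))^-1.

Hypotheses (m2 : (2 <= m)%N) (mn : (m <= n)%N) (c0 : 0 < c) (l0 : (0 < l)%N).
Hypothesis supersaturated : forall G' : sgraph 'I_m,
  a0 < #|edges G'|%:R ->
  c * expected_copies R h l m #|edges G'| <= #|copies H G'|%:R.
Hypothesis a0_le : a0 <= a.
Hypothesis B_cover : forall S, S \in B -> (2 <= #|cover S|)%N.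
Hypothesis B_sparse : \sum_(S in B) q ^+ (#|cover S| - 2) <= e / 2.

(** The default [set0] is never returned on B: a member of B has a nonempty cover, hence an edge. *)
Let pick_edge (S : {set {set 'I_n}}) : {set 'I_n} := odflt set0 [pick x in S].

Let pruned (W : {set 'I_n}) : {set {set 'I_n}} :=
  [set x in edges G | x \subset W] :\:
  [set pick_edge S | S in [set S in B | cover S \subset W]].

Let pick_edgeP S : S \in B -> pick_edge S \in S.
Proof.
move=> /B_cover; rewrite /pick_edge; case: pickP => //= S0.
have -> : S = set0 by apply/setP => x; rewrite inE; apply: S0.
by rewrite /cover big_set0 cards0.
Qed.

Let n0 : (0 < n)%N. Proof. by apply: leq_trans mn; apply: ltnW. Qed.
Let m0 : (0 < m)%N. Proof. exact: ltnW. Qed.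
Let q0 : 0 < q. Proof. by rewrite divr_gt0 ?ltr0n. Qed.
Let a_ge0 : 0 <= a.
Proof. by rewrite !mulr_ge0 ?invr_ge0 ?ler0n ?exprn_ge0 // ltW. Qed.
Let z0 : 0 < z. Proof. by rewrite invr_gt0 exprz_gt0 // ltr0n. Qed.

(** If S in B were contained in A, its cover would lie in W, so its picked edge would have been
    deleted. *)
Let copies_pruned W A : A \in copies H G -> A.2 \subset pruned W -> A \in good.
Proof.
move=> AG AW; rewrite inE AG; apply/forallP => S; apply/implyP => SB.
apply/negP => SA.
have SW := subset_trans SA AW.
have := subsetP SW _ (pick_edgeP SB).
rewrite inE => /andP[/negP + _]; apply; apply: imset_f.
rewrite inE SB; apply/bigcupsP => x /(subsetP SW).
by rewrite !inE => /andP[_ /andP[]].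
Qed.

Let copies_within (W : {set 'I_n}) : #|W| = m ->
  c * z * a ^+ l.-1 * (#|pruned W|%:R - a) <=
    #|[set A in good | sub_verts A \subset W]|%:R.
Proof.
move=> Wm.
have [xa|ax] := leP #|pruned W|%:R a.
  apply: (@le_trans _ _ 0); last exact: ler0n.
  by rewrite mulr_ge0_le0 ?subr_le0 // !mulr_ge0 ?exprn_ge0 // ltW.
have PG : pruned W \subset edges G.
  by apply/subsetP => x; rewrite !inE => /andP[_ /andP[]].
have PW : pruned W \subset powerset W.
  by apply/subsetP => x; rewrite !inE => /andP[_ /andP[]].
have [G' eG' cG'] := restricted_graph H Wm PG PW.
have := supersaturated (G' := G'); rewrite eG' => /(_ (le_lt_trans a0_le ax)).
move=> ES; apply: (le_trans (le_trans _ ES)).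
  rewrite /expected_copies -/z -!mulrA ler_pM2l // [in X in _ <= X]mulrC.
  by rewrite ler_pM2l // tangent_le // ltW.
rewrite ler_nat; apply: leq_trans cG' _; apply/subset_leq_card/subsetP => A.
rewrite 2!inE => /and3P[AG AW AP].
by rewrite AW (copies_pruned AG AP).
Qed.

Let nsupersets_cover S : S \in B -> N #|cover S| <= N 2 * q ^+ (#|cover S| - 2).
Proof.
move=> SB; rewrite mulrC /N -[in X in X <= _](subnKC (B_cover SB)).
rewrite nsupersets_geometric // subnKC ?B_cover //.
by rewrite -[X in (_ <= X)%N](card_ord n) max_card.
Qed.

(** Summed over W, G[W] has N 2 * e edges, and [B_sparse] limits the deletions to half of that;
    [nsupersets2_ge] then compares N 2 with q^2 N 0. *)
Let sum_pruned :
  q ^+ 2 * N 0 * e / 4 <= \sum_(W : {set 'I_n} | #|W| == m) #|pruned W|%:R.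
Proof.
have pW (W : {set 'I_n}) : (#|[set x in edges G | x \subset W]|%:R : R) -
    #|[set S in B | cover S \subset W]|%:R <= #|pruned W|%:R.
  rewrite lerBlDl -natrD ler_nat -leq_subLR cardsD.
  rewrite leq_sub2l // (leq_trans (subset_leq_card (subsetIr _ _))) //.
  exact: leq_imset_card.
apply: le_trans (ler_sum _ (fun W _ => pW W)).
rewrite sumrB -!natr_sum (sum_card_supersets (edges G) id).
rewrite (sum_card_supersets B (@cover _)) card_ord.
rewrite (eq_bigr (fun=> nsupersets n m 2)); last first.
  by move=> x /card_edge ->.
rewrite sum_nat_const natrM -/e -/(N 2).
have BN : (\sum_(S in B) nsupersets n m #|cover S|)%:R <= N 2 * (e / 2).
  rewrite natr_sum; apply: le_trans (ler_wpM2l (ler0n _ _) B_sparse).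
  by rewrite mulr_sumr; apply: ler_sum => S; apply: nsupersets_cover.
have := nsupersets2_ge R m2 mn; rewrite -/q -!/(N _) => N20.
have e0 : 0 <= e by apply: ler0n.
have := ler_wpM2r e0 N20; lra.
Qed.

Let sum_good :
  \sum_(W : {set 'I_n} | #|W| == m) #|[set A in good | sub_verts A \subset W]|%:R
    <= #|good|%:R * (q ^+ h * N 0).
Proof.
rewrite -natr_sum sum_card_supersets card_ord natr_sum.
rewrite mulr_natl -sumr_const; apply: ler_sum => A.
rewrite inE => /andP[AG _]; have Ah := card_copy_verts AG.
rewrite card_ord in Ah; rewrite /sub_verts Ah.
rewrite -[h in X in X <= _]add0n nsupersets_geometric // add0n -Ah.
by rewrite -[X in (_ <= X)%N](card_ord n) max_card.
Qed.

(** The average of [#|pruned W| - a] is at least 2a - a = a, so the tangent bound gives c z a^l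
    copies per sample on average. A copy lies in at most q^h N 0 samples; q^h cancels, and the 8 in
    a leaves [8 ^- l]. *)
Lemma many_copies_avoiding :
  c * (8 ^- l * expected_copies R h l n #|edges G|) <= #|good|%:R.
Proof.
have N0 : 0 < N 0.
  by rewrite /N /nsupersets leq0n !subn0 ltr0n bin_gt0.
have qh : 0 < q ^+ h * N 0 by rewrite mulr_gt0 ?exprn_gt0.
rewrite -(ler_pM2r qh); apply: le_trans sum_good.
have sw : \sum_(W : {set 'I_n} | #|W| == m)
    c * z * a ^+ l.-1 * (#|pruned W|%:R - a) <=
  \sum_(W : {set 'I_n} | #|W| == m)
    (#|[set A in good | sub_verts A \subset W]|%:R : R).
  by apply: ler_sum => W /eqP; apply: copies_within.
apply: le_trans sw; rewrite -mulr_sumr sumrB.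
have -> : \sum_(W : {set 'I_n} | #|W| == m) a = a * N 0.
  rewrite sumr_const -mulr_natr; congr (_ * _%:R).
  rewrite -[in RHS](card_ord n) -[X in nsupersets _ _ X](cards0 'I_n).
  rewrite -card_supersets; apply: eq_card => W.
  by rewrite !inE sub0set.
have cza : 0 <= c * z * a ^+ l.-1 by rewrite !mulr_ge0 ?exprn_ge0 // ltW.
apply: le_trans (ler_wpM2l cza (lerB sum_pruned (lexx _))).
have := expected_copies_restrict R h l #|edges G| n0 m0.
rewrite -/q -/e -/a -/z => eq1.
have -> : c * (8 ^- l * expected_copies R h l n #|edges G|) * (q ^+ h * N 0)
  = c * (q ^+ h * (8 ^- l * expected_copies R h l n #|edges G|)) * N 0 by ring.
have -> : q ^+ 2 * N 0 * e / 4 = 2 * a * N 0 by rewrite /a; move: (q ^+ 2) (N 0) (e) => x y t; field.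
rewrite -eq1 -[X in a ^+ X / _](prednK l0) exprSr -/z.
move: (a) (z) (N 0) => y t w; move: (y ^+ l.-1) => x.
by rewrite le_eqVlt; apply/orP; left; apply/eqP; ring.
Qed.

End Sampling.

(** * Edge sets inside copies: covers and densities *)

Lemma sub_cover (V : finType) (S : {set {set V}}) (e : {set V}) :
  e \in S -> e \subset cover S.
Proof. by move=> eS; rewrite /cover; apply: (bigcup_sup e). Qed.

Lemma card_cover_edges (V : finType) (G : sgraph V) (S : {set {set V}}) :
  S \subset edges G ->
  [/\ #|S| = 1%N -> #|cover S| = 2%N,
      (1 <= #|S| -> 2 <= #|cover S|)%N & (2 <= #|S| -> 3 <= #|cover S|)%N].
Proof.
move=> SG; have e2 e : e \in S -> #|e| = 2%N.
  by move/(subsetP SG)/card_edge.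
have sub := @sub_cover V S.
have ge2 : (1 <= #|S| -> 2 <= #|cover S|)%N.
  by case/card_gt0P => e eS; rewrite -(e2 e eS) subset_leq_card ?sub.
split=> //.
  move/eqP/cards1P => [e Se].
  have -> : cover S = e by rewrite Se /cover big_set1.
  by apply: e2; rewrite Se set11.
case/card_gt1P => e [f [eS fS]]; apply: contraR; rewrite -ltnNge ltnS => le2.
have eqc g : g \in S -> g = cover S.
  by move=> gS; apply/eqP; rewrite eqEcard sub // (e2 g gS).
by rewrite (eqc e eS) -(eqc f fS).
Qed.

(** S and its cover pull back along the embedding to a subgraph F of H with the same counts; the
    last hypothesis makes F differ from [whole H]. *)
Lemma copy_edges_density (R : realType) (U V : finType) (H : sgraph U)
    (G : sgraph V) (A : subgraph V) (S : {set {set V}}) :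
  A \in copies H G -> S \subset A.2 -> (2 <= #|S|)%N ->
  (#|S| < #|edges H|)%N || (#|cover S| < #|U|)%N ->
  (#|S|%:R - 1) / (#|cover S|%:R - 2) <= m2_star R H.
Proof.
move=> AG SA S2 proper.
have S_edges := subset_trans SA (copy_edges_sub AG).
have [_ _ /(_ S2) c3] := card_cover_edges S_edges.
have cA : cover S \subset A.1.
  apply: subset_trans (cover_copy_edges AG).
  by apply/bigcupsP => e /(subsetP SA); apply: sub_cover.
case/copiesP: AG => f [finj A1 A2 _].
have Finj := imset_inj finj.
pose F : subgraph U :=
  (f @^-1: cover S, [set e in edges H | f @: e \in S]).
have im1 : f @: F.1 = cover S.
  apply/setP => x; apply/imsetP/idP => [[y + ->]|xS]; first by rewrite inE.
  have := subsetP cA _ xS; rewrite A1 => /imsetP[y _ xy].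
  by exists y => //; rewrite inE -xy.
have im2 : [set f @: (e : {set U}) | e in F.2] = S.
  apply/setP => s; apply/imsetP/idP => [[e + ->]|sS].
    by rewrite inE => /andP[].
  have := subsetP SA _ sS; rewrite A2 => /imsetP[e eH se].
  by exists e => //; rewrite inE eH -se.
have F1 : #|F.1| = #|cover S| by rewrite -im1 card_imset.
have F2 : #|F.2| = #|S| by rewrite -[in RHS]im2 card_imset.
rewrite -F1 -F2; apply: (@le_bigmax_cond _ _ _ (-1) F _ (@density R U)).
rewrite /sub_verts F1 c3 andbT; apply/andP; split; last first.
  apply: contraTneq proper => FH; rewrite -F1 -F2 FH /whole /= cardsT.
  by rewrite !ltnn.
rewrite /subgraphs inE /sub_edges /sub_verts; apply/andP; split.
  by apply/subsetP => e; rewrite inE => /andP[].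
apply/subsetP => e; rewrite inE powersetE => /andP[_ eS].
apply/subsetP => x xe; rewrite inE.
by apply: (subsetP (sub_cover eS)); apply: imset_f.
Qed.

(** The bound on the cover says that A has no isolated vertex, so its vertex set is recovered from
    its edges. *)
Lemma copy_edges_inj (U V : finType) (H : sgraph U) (G : sgraph V)
    (A A' : subgraph V) :
  A \in copies H G -> A' \in copies H G -> (#|U| <= #|cover A.2|)%N ->
  A.2 \subset A'.2 -> A = A'.
Proof.
move=> AG A'G cU sub.
have e2 : A.2 = A'.2.
  by apply/eqP; rewrite eqEcard sub (card_copy_edges AG) (card_copy_edges A'G) /=.
have cov B : B \in copies H G -> (#|U| <= #|cover B.2|)%N -> cover B.2 = B.1.
  move=> BG cB; apply/eqP.
  by rewrite eqEcard (cover_copy_edges BG) (card_copy_verts BG).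
have e1 : A.1 = A'.1 by rewrite -(cov A) // e2 cov // -e2.
by case: A A' e1 e2 {sub AG A'G cU} => [A1 A2] [A'1 A'2] /= -> ->.
Qed.

(** * Codegrees and the maximal balanced family *)

Lemma sum_codegree (U V : finType) (H : sgraph U)
    (G : sgraph V) (F : {set subgraph V}) :
  F \subset copies H G ->
  (\sum_(S : {set {set V}}) codegree F S = 2 ^ #|edges H| * #|F|)%N.
Proof.
move=> FG.
have cE (S : {set {set V}}) :
    codegree F S = (\sum_(A in F) if S \subset sub_edges A then 1 else 0)%N.
  rewrite /codegree -sum1_card -big_mkcondr.
  by apply: eq_bigl => A; rewrite inE.
rewrite (eq_bigr _ (fun S _ => cE S)) exchange_big /=.
rewrite (eq_bigr (fun=> 2 ^ #|edges H|)%N); first by rewrite sum_nat_const mulnC.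
move=> A AF; rewrite -big_mkcond sum1dep_card /= -(card_copy_edges (subsetP FG _ AF)).
by rewrite -card_powerset; apply: eq_card => S; rewrite !inE.
Qed.

(* A maximal family with codegrees at most D: every copy outside it contains a
   saturated edge set, so a family with few members saturates few sets. *)
Lemma balanced_family (R : realType) (U V : finType) (H : sgraph U)
    (G : sgraph V) (D : nat -> R) (M : R) :
  (forall j, (1 <= j <= #|edges H|)%N -> 2 <= D j) ->
  (forall B : {set {set {set V}}},
     (forall S, S \in B ->
        [/\ (0 < #|S|)%N, exists2 A, A \in copies H G & S \subset A.2
          & (#|S| < #|edges H|)%N || (#|cover S| < #|U|)%N]) ->
     \sum_(S in B) D #|S| <= 2 ^+ #|edges H|.+1 * M ->
     M <= #|[set A in copies H G |
              [forall S in B, ~~ (S \subset sub_edges A)]]|%:R) ->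
  exists2 F : {set subgraph V}, F \subset copies H G &
    M <= #|F|%:R /\
    forall S : {set {set V}}, S \subset edges G ->
      (1 <= #|S| <= #|edges H|)%N -> (codegree F S)%:R <= D #|S|.
Proof.
set l := #|edges H| => D2 many.
pose P (F : {set subgraph V}) := (F \subset copies H G) &&
  [forall S : {set {set V}}, (S \subset edges G) && (1 <= #|S| <= l)%N ==>
     ((codegree F S)%:R <= D #|S|)].
have [|F /maxsetP[/andP[FG /forallP FD] Fmax]] := @ex_maxset _ P.
  exists set0; rewrite /P sub0set /=; apply/forallP => S.
  apply/implyP => /andP[_ /D2 S2].
  rewrite /codegree (_ : [set A in set0 | _] = set0) ?cards0; first by lra.
  by apply/setP => A; rewrite !inE.
exists F => //; split; last first.
  by move=> S SG Sl; have /implyP := FD S; apply; rewrite SG.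
rewrite leNgt; apply/negP => FM.
(* Saturated sets: one more copy through S would break the bound. The last clause leaves out the
   full edge set of a copy without isolated vertices. *)
pose B := [set S : {set {set V}} | [&& (1 <= #|S| <= l)%N,
  D #|S| < (codegree F S).+1%:R & (#|S| < l)%N || (#|cover S| < #|U|)%N]].
(* From 2 <= D < codegree + 1 the codegree exceeds 1, hence codegree + 1 <= 2 * codegree. *)
have BD S : S \in B -> D #|S| <= 2 * (codegree F S)%:R.
  rewrite inE => /and3P[/D2 S2 + _]; rewrite -natr1; lra.
suff avoid : #|[set A in copies H G |
    [forall S in B, ~~ (S \subset sub_edges A)]]|%:R <= #|F|%:R :> R.
  move: (FM); rewrite ltNge => /negP; apply; apply: le_trans avoid; apply: many.
  - move=> S SB; have := BD S SB; move: (SB); rewrite inE.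
    case/and3P => S1l _ -> ; have S2 := D2 _ S1l => Scod.
    case/andP: S1l => -> _; split=> //.
    have : (0 < codegree F S)%N by rewrite -(ltr_nat R); lra.
    case/card_gt0P => A; rewrite inE => /andP[AF SA].
    by exists A => //; apply: (subsetP FG).
  - apply: (@le_trans _ _ (\sum_(S : {set {set V}}) 2 * (codegree F S)%:R)).
      rewrite [X in _ <= X](bigID (mem B)) /= -[X in X <= _]addr0.
      apply: lerD; first by apply: ler_sum => S /BD.
      by apply: sumr_ge0 => S _; rewrite mulr_ge0.
    rewrite -mulr_sumr -natr_sum (sum_codegree FG) natrM natrX exprS -mulrA.
    apply: ler_wpM2l => //.
    by apply: ler_wpM2l; rewrite ?exprn_ge0 // ltW.
rewrite ler_nat subset_leq_card //.
apply/subsetP => A; rewrite inE => /andP[AG /forallP Agood].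
apply/negPn/negP => AF.
(* By maximality it is enough that A can be added to F without violating a codegree bound. *)
suff PA : P (A |: F) by move: AF; rewrite -(Fmax _ PA (subsetUr _ _)) setU11.
rewrite /P subUset sub1set AG FG /=; apply/forallP => S.
apply/implyP => /andP[SG S1l].
have codU : (codegree (A |: F) S <= (S \subset sub_edges A) + codegree F S)%N.
  rewrite /codegree; case SA: (S \subset sub_edges A).
    rewrite -[nat_of_bool true]/1%N -(cards1 A) (leq_trans _ (leq_card_setU _ _).1) //.
    apply/subset_leq_card/subsetP => A'; rewrite !inE.
    by case/andP => /orP[->|->] // ->; rewrite orbT.
  rewrite add0n subset_leq_card //; apply/subsetP => A'; rewrite !inE.
  by case/andP => /orP[/eqP ->|->] //; rewrite SA.
apply: (@le_trans _ _ ((S \subset sub_edges A) + codegree F S)%N%:R).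
  by rewrite ler_nat.
case SA: (S \subset sub_edges A); last first.
  by have /implyP := FD S; apply; rewrite SG.
have := Agood S; rewrite SA implybF inE S1l /= negb_and -leNgt negb_or -!leqNgt.
(* Either S has room for one more copy, or S is all of [A.2] and spans A. In the second case a
   member of F containing S would be A itself, so the codegree is 0. *)
case/orP => [//|/andP[lS cS]].
have SA2 : S = A.2.
  by apply/eqP; rewrite eqEcard SA (card_copy_edges AG).
suff -> : codegree F S = 0%N by apply: le_trans (D2 _ S1l); rewrite ler1n.
apply/eqP; rewrite cards_eq0; apply/eqP/setP => A'; rewrite !inE.
apply/negP => /andP[A'F SA'].
move: AF; rewrite (copy_edges_inj AG (subsetP FG _ A'F)) ?A'F // -SA2 //.
Qed.

(** * Exponents and the choice of the sample size *)

Lemma card_edges_le (V : finType) (G : sgraph V) : (#|edges G| <= #|V| ^ 2)%N.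
Proof.
apply: leq_trans (_ : 'C(#|V|, 2) <= _)%N.
  rewrite -card_draws; apply/subset_leq_card/subsetP => e /card_edge e2.
  by rewrite inE e2.
by rewrite bin2 -divn2 (leq_trans (leq_div _ _)) // -mulnn leq_mul2l leq_pred orbT.
Qed.

Section Exponents.

Variables (R : realType) (h : nat) (H : sgraph 'I_h) (alpha : R).
Hypothesis H_two_edges : (2 <= #|edges H|)%N.

Lemma card_verts_gt2 : (2 < h)%N.
Proof.
have [_ _ /(_ H_two_edges) c3] := card_cover_edges (subxx (edges H)).
by rewrite -[h]card_ord (leq_trans c3) ?max_card.
Qed.

(** One edge on the full vertex set has density 0, and is proper because H has two edges. *)
Lemma m2_star_ge0 : 0 <= m2_star R H.
Proof.
case/card_gt1P: (H_two_edges) => e [f [eH fH ef]].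
pose F : subgraph 'I_h := ([set: 'I_h], [set e]).
have -> : 0 = density R F by rewrite /density /= cards1 subrr mul0r.
apply: (@le_bigmax_cond _ _ _ (-1) F _ (@density R 'I_h)).
rewrite /sub_verts /= cardsT card_ord card_verts_gt2 andbT; apply/andP; split.
  rewrite inE /sub_edges sub1set eH; apply/subsetP => x _.
  by rewrite powersetE subsetT.
apply/negP => /eqP[eqF]; move: fH; rewrite -eqF inE => /eqP fe.
by rewrite fe eqxx in ef.
Qed.

(** H itself competes in [m2], so alpha > 2 - (h - 2) / (l - 1); multiplied by l - 1 this says that
    the numerator of [phi] is positive. *)
Lemma phi_gt0 : 2 - 1 / m2 R H < alpha -> 0 < phi H alpha.
Proof.
move=> a_gt.
have h2 : 0 < h%:R - 2 :> R by rewrite subr_gt0 ltr_nat card_verts_gt2.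
have l1 : 0 < #|edges H|%:R - 1 :> R by rewrite subr_gt0 ltr1n.
have dm : (#|edges H|%:R - 1) / (h%:R - 2) <= m2 R H.
  have -> : (#|edges H|%:R - 1) / (h%:R - 2) = density R (whole H).
    by rewrite /density /= cardsT card_ord.
  apply: (@le_bigmax_cond _ _ _ (-1) _ _ (@density R 'I_h)).
  rewrite /sub_verts /= cardsT card_ord card_verts_gt2 andbT.
  rewrite inE subxx; apply/subsetP => x _.
  by rewrite powersetE subsetT.
have d0 : 0 < (#|edges H|%:R - 1) / (h%:R - 2) :> R by rewrite divr_gt0.
have : 1 / m2 R H <= (h%:R - 2) / (#|edges H|%:R - 1).
  by rewrite div1r -[X in _ <= X]invf_div lef_pV2 ?posrE // (lt_le_trans d0).
move=> mle; rewrite /phi divr_gt0 //.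
have : 2 - (h%:R - 2) / (#|edges H|%:R - 1) < alpha.
  by apply: le_lt_trans a_gt; rewrite lerD2l lerN2.
rewrite -(ltr_pM2r l1) mulrBl divfK ?gt_eqF //.
move: (#|edges H|%:R : R) => l; lra.
Qed.

(** [phi] is the exponent with n^(phi (l - 1)) = n^(alpha (l - 1)) / n^(2l - h); up to constants, an
    edge lies in (k n^phi)^(l - 1) expected copies. *)
Lemma expected_copies_ratio (n e : nat) (k : R) :
  (0 < n)%N -> 0 < k -> e%:R = k * n%:R `^ alpha ->
  expected_copies R h #|edges H| n e =
    (k * n%:R `^ phi H alpha) ^+ (#|edges H| - 1) * e%:R.
Proof.
move=> n0 k0 eE; set l := #|edges H|.
have nR : 0 < n%:R :> R by rewrite ltr0n.
have l1 : (l%:R - 1 : R) = (l - 1)%:R by rewrite natrB // ltnW.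
have l1N : (l - 1)%:R != 0 :> R by rewrite pnatr_eq0 -lt0n subn_gt0.
have np : n%:R `^ phi H alpha ^+ (l - 1) =
    n%:R `^ alpha ^+ (l - 1) / n%:R ^ ((2 * l)%N%:Z - h%:Z) :> R.
  rewrite -!powR_mulrn ?powR_ge0 // -!powRrM -powR_intmul ?ler0n //.
  rewrite -powRB ?(gt_eqF nR) ?implybT //; congr (_ `^ _).
  rewrite /phi -/l l1 divfK // -l1 rmorphB /= -!pmulrn natrM; ring.
have lS : (0 < l)%N by apply: ltnW.
rewrite /expected_copies -[X in _ ^+ X / _](subnK lS) addn1 exprSr.
by rewrite [in RHS]exprMn np {1}eE exprMn [in RHS]mulrA [RHS]mulrAC.
Qed.

(* p is the sampling density K * k ^ (-1 / (2 - alpha)); the exponent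
   1 / m2_star then turns p into k ^ (- lambda_star). *)
Lemma sampling_le_beta (K k : R) (n v j : nat) :
  alpha < 2 -> 1 <= K -> 0 < k -> K * k `^ (- (1 / (2 - alpha))) <= 1 ->
  (3 <= v)%N -> (2 <= j <= #|edges H|)%N ->
  (j%:R - 1) / (v%:R - 2) <= m2_star R H ->
  (K * k `^ (- (1 / (2 - alpha)))) ^+ (v - 2) <=
    (K `^ (1 / m2_star R H)) ^+ #|edges H| * beta H alpha k n ^+ (j - 1).
Proof.
move=> a2 K1 k0; set p := K * _ => p1 v3 /andP[j2 jl] dens.
have p0 : 0 < p by rewrite mulr_gt0 ?powR_gt0 // (lt_le_trans ltr01).
have v2 : 0 < v%:R - 2 :> R by rewrite subr_gt0 ltr_nat.
have j1 : 0 < j%:R - 1 :> R by rewrite subr_gt0 ltr1n.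
(* Two or more edges force a positive density, so the special value 0 in [beta] does not occur
   here. *)
have mu0 : 0 < m2_star R H by apply: lt_le_trans dens; rewrite divr_gt0.
set mu := m2_star R H in dens mu0 *.
have K1mu : 1 <= K `^ (1 / mu).
  by rewrite -[X in X <= _](powRr0 K) ler_powR // divr_ge0 // ltW.
have pmu : p `^ (1 / mu) <= K `^ (1 / mu) * beta H alpha k n.
  rewrite /p powRM ?powR_ge0 ?(le_trans ler01) //.
  rewrite ler_wpM2l ?powR_ge0 // -powRrM /beta -/mu gt_eqF // le_max.
  apply/orP; right; rewrite /lambda_star -/mu.
  rewrite le_eqVlt; apply/orP; left; apply/eqP; congr (_ `^ _).
  by field; rewrite !gt_eqF //= subr_gt0.
(* As p <= 1, the exponent v - 2 may be lowered to (j - 1) / mu. *)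
apply: (@le_trans _ _ (p `^ (1 / mu) ^+ (j - 1))).
  rewrite -!powR_mulrn ?powR_ge0 ?(ltW p0) // -powRrM ger_powR ?p0 //.
  rewrite !natrB // ?(ltnW v3) ?(ltnW j2) // mulrAC mul1r ler_pdivrMr //.
  by rewrite mulrC -ler_pdivrMr.
apply: (@le_trans _ _ ((K `^ (1 / mu) * beta H alpha k n) ^+ (j - 1))).
  by rewrite lerXn2r ?nnegrE ?powR_ge0 // (le_trans (powR_ge0 _ _) pmu).
rewrite exprMn ler_wpM2r ?exprn_ge0 //.
  by rewrite /beta le_max mulr_ge0 ?powR_ge0 ?divr_ge0 // ltW.
(* Raising the power from j - 1 to l makes the constant independent of j. *)
by rewrite ler_weXn2l // (leq_trans (leq_subr _ _)).
Qed.

(** The choice is m = floor(p n) with p = K / r and r = k^(1 / (2 - alpha)). The bound on k gives K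
    <= r, so p <= 1; e <= n^2 gives r <= n, so p n >= K, which exceeds both [n0] and 2. *)
Lemma sample_size (K k C' : R) (n n0 e : nat) :
  alpha < 2 -> 0 < C' -> 2 <= K -> n0%:R <= K ->
  2 * (8 * C') `^ (1 / (2 - alpha)) <= K -> K `^ (2 - alpha) <= k ->
  (0 < n)%N -> (e <= n ^ 2)%N -> e%:R = k * n%:R `^ alpha ->
  K * k `^ (- (1 / (2 - alpha))) <= 1 /\
  exists2 m : nat, [/\ (n0 <= m)%N, (2 <= m)%N & (m <= n)%N] &
    m%:R / n%:R <= K * k `^ (- (1 / (2 - alpha))) /\
    C' * m%:R `^ alpha <= (m%:R / n%:R) ^+ 2 * e%:R / 8.
Proof.
move=> a2 C'0 K2 Kn0 KC Kk npos en eE.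
set t := 2 - alpha in KC Kk *; have t0 : 0 < t by rewrite subr_gt0.
have nR : 0 < n%:R :> R by rewrite ltr0n.
have K0 : 0 < K by apply: lt_le_trans K2.
have k0 : 0 < k by apply: lt_le_trans Kk; rewrite powR_gt0.
have it0 : 0 <= 1 / t by rewrite divr_ge0 // ltW.
have rootK (x : R) : 0 <= x -> (x `^ t) `^ (1 / t) = x.
  by move=> x0; rewrite -powRrM mulrC divfK ?gt_eqF // powRr1.
have rootK' (x : R) : 0 <= x -> (x `^ (1 / t)) `^ t = x.
  by move=> x0; rewrite -powRrM divfK ?gt_eqF // powRr1.
rewrite powRN; set r := k `^ (1 / t).
have r0 : 0 < r by rewrite powR_gt0.
have Kr : K <= r.
  rewrite -(rootK K) ?(ltW K0) // ge0_ler_powR ?nnegrE ?powR_ge0 //.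
  exact: ltW.
have kn : k <= n%:R `^ t.
  rewrite powRB ?(gt_eqF nR) ?implybT // ler_pdivlMr ?powR_gt0 //.
  by rewrite -eE powR_mulrn // -natrX ler_nat.
have rn : r <= n%:R.
  rewrite -(rootK n%:R) // ge0_ler_powR ?nnegrE ?powR_ge0 //.
  exact: ltW.
set p := K / r.
have p0 : 0 < p by rewrite divr_gt0.
have p1 : p <= 1 by rewrite ler_pdivrMr // mul1r.
have Kpn : K <= p * n%:R by rewrite mulrAC ler_pdivlMr // ler_pM2l.
split=> //.
have pn0 : 0 <= p * n%:R by rewrite mulr_ge0 // ltW.
have /andP[mle mgt] := truncn_itv pn0.
set m := Num.truncn _ in mle mgt.
have m2 : (2 <= m)%N by rewrite truncn_ge_nat // (le_trans K2).
exists m; first split=> //.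
- by rewrite truncn_ge_nat // (le_trans Kn0).
- by rewrite -(ler_nat R) (le_trans mle) // ler_piMl // ltW.
have m0 : 0 < m%:R :> R by rewrite ltr0n ltnW.
set q := m%:R / n%:R.
have q0 : 0 < q by rewrite divr_gt0.
(* Rounding down loses at most a factor 2, since p n < m + 1 <= 2m. *)
have qp : p / 2 <= q.
  rewrite /q ler_pdivlMr // mulrAC ler_pdivrMr //.
  apply: le_trans (ltW mgt) _; rewrite -natrM ler_nat.
  by rewrite muln2 -addnn -addn1 leq_add2l ltnW.
split; first by rewrite /q ler_pdivrMr.
have -> : m%:R = q * n%:R by rewrite /q divfK ?gt_eqF.
rewrite powRM ?(ltW q0) ?(ltW nR) // eE.
have q2 : q ^+ 2 = q `^ alpha * q `^ t.
  rewrite -powRD ?(gt_eqF q0) ?implybT // /t addrC subrK.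
  by rewrite powR_mulrn // ltW.
(* Here k = r^t and q r >= K / 2 >= (8 C')^(1 / t), by the third lower bound on K. *)
have qt : 8 * C' <= q `^ t * k.
  have kr : k = r `^ t by rewrite /r rootK' // ltW.
  have C8 : 0 <= 8 * C' by rewrite mulr_ge0 // ltW.
  rewrite {1}kr -powRM ?(ltW q0) ?(ltW r0) // -(rootK' (8 * C')) //.
  rewrite ge0_ler_powR ?nnegrE ?powR_ge0 ?mulr_ge0 ?(ltW r0) ?(ltW t0) ?invr_ge0 //.
  have := ler_wpM2r (ltW r0) qp; rewrite /p mulrAC divfK ?gt_eqF // => qr.
  by apply: le_trans qr; rewrite ler_pdivlMr // mulrC.
rewrite q2.
have w0 : 0 <= q `^ alpha * n%:R `^ alpha by rewrite mulr_ge0 ?powR_ge0.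
have := ler_wpM2r w0 qt; move: (q `^ alpha) (n%:R `^ alpha) (q `^ t) => x y z; lra.
Qed.

End Exponents.

(** * Choice of constants and conclusion *)

(** The empty family serves: the expected count is 0 and no nonempty S exists. *)
Lemma edgeless_balanced (R : realType) (U V : finType) (H : sgraph U)
    (G : sgraph V) (h n : nat) (delta : R)
    (b : {set {set V}} -> R) :
  (0 < #|edges H|)%N -> #|edges G| = 0%N ->
  exists2 F : {set subgraph V}, F \subset copies H G &
    delta * expected_copies R h #|edges H| n #|edges G| <= #|F|%:R /\
    (forall S : {set {set V}}, S \subset edges G ->
       (1 <= #|S| <= #|edges H|)%N ->
       (codegree F S)%:R <= b S * (#|F|%:R / #|edges G|%:R)).
Proof.
move=> l0 e0; exists set0; first exact: sub0set.
rewrite /expected_copies e0 expr0n gtn_eqF // mul0r mulr0 cards0; split=> // S SG.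
move/andP=> [S1 _]; have := subset_leq_card SG; by rewrite e0 leqNgt S1.
Qed.

Theorem theorem2p3 (R : realType) (h : nat) (H : sgraph 'I_h) (alpha A : R)
    (H_bipartite : bipartite H)
    (H_two_edges : (2 <= #|edges H|)%N)
    (alpha_gt0 : 0 < alpha)
    (A_gt0 : 0 < A)
    (A_ge16 : 16 <= A)
    (alpha_gt : 2 - 1 / m2 R H < alpha)
    (ex_le : forall n : nat, (ex n H)%:R <= A * n%:R `^ alpha)
    (H_good : ES_good H alpha) :
  exists delta k0 C : R, [/\ 0 < delta, 0 < k0, 0 < C &
    forall (n : nat) (G : sgraph 'I_n) (k : R),
      k0 <= k ->
      #|edges G|%:R = k * n%:R `^ alpha ->
      exists2 F : {set subgraph 'I_n}, F \subset copies H G &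
        delta * expected_copies R h #|edges H| n #|edges G| <= #|F|%:R /\
        (forall S : {set {set 'I_n}}, S \subset edges G ->
           (1 <= #|S| <= #|edges H|)%N ->
           (codegree F S)%:R <=
             C * beta H alpha k n ^+ (#|S| - 1) * (#|F|%:R / #|edges G|%:R))].
Proof.
set l := #|edges H|.
have lpos : (0 < l)%N := ltnW H_two_edges.
have [a2|a2] := ltP alpha 2; last first.
  (* For alpha >= 2 and k >= 2, a graph with an edge would have at least 2 n^2 edges, more than
     possible; so G is edgeless. *)
  exists 1, 2, 1; split=> // n G k k2 eE.
  apply: edgeless_balanced => //; apply/eqP; rewrite -leqn0 leqNgt.
  apply/negP => e0; have := card_edges_le G; rewrite card_ord leqNgt.
  have n0 : (0 < n)%N.
    rewrite lt0n; apply: contraTneq e0 => nz; rewrite -(ltr_nat R) eE nz.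
    by rewrite powR0 ?gt_eqF // mulr0 ltxx.
  move/negP; apply; rewrite -(ltr_nat R) eE natrX.
  have n2 : 0 < n%:R ^+ 2 :> R by rewrite exprn_gt0 // ltr0n.
  have : n%:R ^+ 2 <= n%:R `^ alpha :> R.
    by rewrite -powR_mulrn // ler_powR // ler1n.
  move=> n2a; apply: (@lt_le_trans _ _ (2 * n%:R ^+ 2)); first by lra.
  by apply: ler_pM => //; rewrite ltW.
have [C' [c [C'0 c0 [n0 ES]]]] := H_good.
have phi0 := phi_gt0 H_two_edges alpha_gt.
(* The sum of the three lower bounds required by [sample_size]. *)
pose K : R := 2 + n0%:R + 2 * (8 * C') `^ (1 / (2 - alpha)).
have KC0 : 0 <= 2 * (8 * C') `^ (1 / (2 - alpha)) by rewrite mulr_ge0 ?powR_ge0.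
have n0R : 0 <= n0%:R :> R by [].
have [K2 Kn0 KC] : [/\ 2 <= K, n0%:R <= K & 2 * (8 * C') `^ (1 / (2 - alpha)) <= K].
  by rewrite /K; split; lra.
have K1 : 1 <= K by apply: le_trans K2; rewrite ler1n.
pose k0 := K `^ (2 - alpha).
have k01 : 1 <= k0.
  by rewrite -[X in X <= _](powRr0 K) ler_powR // subr_ge0 ltW.
pose delta := c * 8 ^- l.
have delta0 : 0 < delta by rewrite mulr_gt0 ?invr_gt0 ?exprn_gt0.
pose K' := (K `^ (1 / m2_star R H)) ^+ l.
have K'1 : 1 <= K'.
  rewrite exprn_ege1 // -[X in X <= _](powRr0 K) ler_powR // divr_ge0 //.
  exact: m2_star_ge0.
have K'0 : 0 < K' by apply: lt_le_trans K'1.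
(* The first summand makes every [D j] at least 2; the second makes the saturated sets sparse enough
   for sampling. *)
pose C := 2 / delta + K' * 2 ^+ l.+2.
have C1 : 0 < 2 / delta by rewrite divr_gt0.
have C2 : 0 < K' * 2 ^+ l.+2 by apply: mulr_gt0 => //; apply: exprn_gt0.
have C0 : 0 < C by apply: addr_gt0.
exists delta, k0, C; split=> //; first exact: lt_le_trans k01.
move=> n G k k0k eE.
have [e0|epos] := posnP #|edges G|; first by apply: edgeless_balanced.
have k1 : 1 <= k := le_trans k01 k0k.
have kpos : 0 < k by apply: lt_le_trans k1.
have npos : (0 < n)%N.
  rewrite lt0n; apply: contraTneq epos => nz; rewrite -(ltr_nat R) eE nz.
  by rewrite powR0 ?gt_eqF // mulr0 ltxx.
have en : (#|edges G| <= n ^ 2)%N by have := card_edges_le G; rewrite card_ord.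
have [p1 [m [n0m m2 mn] [qp mC']]] :=
  sample_size a2 C'0 K2 Kn0 KC k0k npos en eE.
set e : R := #|edges G|%:R in eE *.
have eR : 0 < e by rewrite ltr0n.
pose M := delta * expected_copies R h l n #|edges G|.
set b := beta H alpha k n.
pose T := k * n%:R `^ phi H alpha.
have Me : M / e = delta * T ^+ (l - 1).
  rewrite /M (expected_copies_ratio H_two_edges npos kpos eE) mulrA mulfK //.
  exact: lt0r_neq0.
have T1 : 1 <= T.
  rewrite -[X in X <= _]mulr1 ler_pM // -[X in X <= _](powRr0 n%:R).
  by rewrite ler_powR ?ler1n // ltW.
have T0 : 0 < T by apply: lt_le_trans T1.
have M0 : 0 < M.
  have : 0 < M / e by rewrite Me mulr_gt0 ?exprn_gt0.
  by rewrite pmulr_lgt0 ?invr_gt0.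
have bT : T^-1 <= b by rewrite /b /beta le_max /T invfM powRN div1r lexx.
have b0 : 0 < b by apply: lt_le_trans bT; rewrite invr_gt0.
pose D (j : nat) := C * b ^+ (j - 1) * (M / e).
(* Since b T >= 1, T >= 1 and j <= l, the product b^(j - 1) T^(l - 1) is at least 1, and C * delta
   >= 2. *)
have D2 j : (1 <= j <= l)%N -> 2 <= D j.
  case/andP=> j1 jl; rewrite /D Me.
  have bTj : 1 <= b ^+ (j - 1) * T ^+ (l - 1).
    apply: (@le_trans _ _ (b ^+ (j - 1) * T ^+ (j - 1))).
      by rewrite -exprMn exprn_ege1 // -ler_pdivrMr // div1r.
    rewrite ler_wpM2l ?exprn_ge0 ?(ltW b0) //.
    by rewrite ler_weXn2l // leq_sub2r.
  have Cd : 2 <= C * delta by rewrite -ler_pdivrMr // lerDl ltW.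
  by rewrite mulrACA -[X in X <= _]mulr1 ler_pM.
have [|F FG [MF FD]] := @balanced_family R _ _ H G D M D2; last first.
  exists F => //; split=> // S SG Sl; apply: le_trans (FD S SG Sl) _.
  rewrite ler_wpM2l ?mulr_ge0 ?exprn_ge0 ?(ltW C0) ?(ltW b0) //.
  by rewrite ler_wpM2r // invr_ge0 ltW.
move=> B Bprop BD; rewrite /M /delta -mulrA.
have Bedges S : S \in B -> S \subset edges G.
  by case/Bprop => _ [X /copy_edges_sub XG SX] _; apply: subset_trans XG.
have Bcover S : S \in B -> (2 <= #|cover S|)%N.
  move=> SB; have [S0 _ _] := Bprop S SB.
  by have [_ /(_ S0)] := card_cover_edges (Bedges S SB).
apply: (many_copies_avoiding (a0 := C' * m%:R `^ alpha) m2 mn) => //.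
  by move=> G' G'e; apply: ES.
(* Each weight q^(v(S) - 2) is at most K' b^(|S| - 1), a fixed multiple of [D #|S|], so [BD] bounds
   the whole sum. *)
apply: (@le_trans _ _ (\sum_(S in B) K' * e / (C * M) * D #|S|)).
  apply: ler_sum => S SB.
  have q0 : 0 <= m%:R / n%:R :> R by rewrite divr_ge0.
  apply: (@le_trans _ _ (K' * b ^+ (#|S| - 1))); last first.
    rewrite le_eqVlt; apply/orP; left; apply/eqP; rewrite /D.
    move: (b ^+ (#|S| - 1)) => x; field.
    by rewrite !gt_eqF.
  have [S0 [X XG SX] proper] := Bprop S SB.
  have [cov1 cov2 cov3] := card_cover_edges (Bedges S SB).
  move: S0; rewrite leq_eqVlt => /orP[/eqP S1|S2].
    (* A single edge covers two vertices: both exponents are 0, and K' >= 1 suffices. *)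
    by rewrite -S1 cov1 // !subnn !expr0 mulr1.
  have Sl : (2 <= #|S| <= l)%N.
    by have := subset_leq_card SX; rewrite (card_copy_edges XG) S2.
  apply: (@le_trans _ _ ((K * k `^ (- (1 / (2 - alpha)))) ^+ (#|cover S| - 2))).
    by rewrite lerXn2r ?nnegrE // (le_trans q0).
  apply: sampling_le_beta => //; first exact: cov3.
  exact: copy_edges_density XG SX S2 proper.
rewrite -mulr_sumr.
have CM0 : 0 <= K' * e / (C * M) by rewrite ltW // divr_gt0 // mulr_gt0.
apply: le_trans (ler_wpM2l CM0 BD) _.
have -> : K' * e / (C * M) * (2 ^+ l.+1 * M) = K' * 2 ^+ l.+1 * e / C.
  by move: (2 ^+ l.+1) => x; field; rewrite !gt_eqF.
rewrite ler_pdivrMr //.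
(* The sum is now at most K' 2^(l + 1) e / C, and the second summand of C turns this into e / 2. *)
have : K' * 2 ^+ l.+2 <= C by rewrite lerDr ltW.
rewrite exprS -/e => /(ler_wpM2r (ltW eR)).
by move: (K') (C) (e) (2 ^+ l.+1) => u v w x; clear; lra.
Qed.
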